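(* Let $n$ be an even positive integer and let $\mathbb{F}$ be a field with $\operatorname{char}(\mathbb{F})\neq 2$ and $|\mathbb{F}|\geq n^2+1$. Let $Q_n$ denote the set of all $n\times n$ skew-symmetric matrices over $\mathbb{F}$. Let $\phi,\psi:Q_n\to Q_n$ be maps such that $\psi$ is surjective, $\psi(0)=0$, and $$\det(\phi(x)+\psi(y))=\det(x+y)\qquad\text{for all } x,y\in Q_n.$$ Then $\phi=\psi$, and $\psi$ is a bijective linear map satisfying $\det(\psi(x))=\det(x)$ for all $x\in Q_n$.
   Context: A matrix $x$ is skew-symmetric if $x^t=-x$. *)

(* Defs.v *)
From mathcomp Require Import all_boot all_order all_algebra.
Set Implicit Arguments. Unset Strict Implicit. Unset Printing Implicit Defensive.
Import GRing.Theory.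
Local Open Scope ring_scope.

Definition skewsym (F : fieldType) (n : nat) (x : 'M[F]_n) : Prop := x^T = - x.

Definition card_ge (F : fieldType) (k : nat) : Prop :=
  exists s : seq F, uniq s /\ size s = k.

(* Main.v *)
(** Second differences in [s] of [\det (z + s J)], with [J] of rank 2, delete two
    rows and columns of [z]; so if [\det (w + z)] lies in a given linear space of
    functions for every skew [w], then so do the even principal minors of [z], in
    particular [z i j ^+ 2] and, on shifting, [z i j] itself.  A Gram matrix
    [\det (x i + y j)] of maximal size expresses every [\det (w + psi y)] as a
    combination of functions [\det (x i + y)].  Hence [psi] and its inverse are at
    most quadratic on lines whose direction has rank 2, with at most quadratic
    squares of entries, i.e. affine, and they preserve the rank 2 directions.  The
    mixed second difference of [psi] then vanishes along two directions whose sum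
    is of rank at most 2; along [e_i ^ e_j] and [e_k ^ e_l] it is alternating, and
    pulling it back by the inverse of [psi] yields a matrix whose nonzero entries
    would have index pairs meeting every pair from [{i, j, k, l}].  So [psi] is
    linear, and [phi = psi] by nondegeneracy of [(x, y) |-> \det (x + y)]. *)

Require Import Defs.
From mathcomp Require Import all_boot all_order all_algebra all_fingroup ring zify.
From Stdlib Require Import Classical.
Import GRing.Theory.
Local Open Scope ring_scope.

(** * Principal minors of skew perturbations *)

Lemma det_add_delta (R : comNzRingType) n (A : 'M[R]_n) i j a :
  \det (A + a *: delta_mx i j) = \det A + a * cofactor A i j.
Proof.
rewrite !(expand_det_row _ i).
transitivity (\sum_k (A i k * cofactor A i k + (a *+ (k == j)) * cofactor A i k)).
  apply: eq_bigr => k _; rewrite !mxE eqxx /= mulr_natr -mulrDl; congr (_ * _).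
  rewrite /cofactor; congr (_ * \det _); apply/matrixP=> p q.
  by rewrite !mxE eq_sym (negbTE (neq_lift _ _)) /= mulr0 addr0.
rewrite big_split /=; congr (_ + _).
rewrite (bigD1 j) //= eqxx big1 ?addr0 // => k /negbTE->.
by rewrite mulr0n mul0r.
Qed.

Definition shift2 {n} (i : 'I_n) : 'I_n.+2 := lift ord0 (lift ord0 i).

(** As a function of [s], [\det (A + s *: J)] is quadratic, and its leading coefficient is the minor
    that omits the first two rows and columns. The two nonzero entries of [J] are inserted one after
    the other. *)
Lemma det_second_difference (R : comNzRingType) n (A : 'M[R]_n.+2) :
  let J := delta_mx ord0 (lift ord0 ord0) - delta_mx (lift ord0 ord0) ord0 in
  \det (A + J) + \det (A - J) - 2%:R * \det A
  = 2%:R * \det (mxsub shift2 shift2 A).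
Proof.
move=> J; set o : 'I_n.+2 := lift ord0 ord0.
have cofE s : cofactor (A + s *: delta_mx ord0 o) o ord0
    = cofactor A o ord0 - s * \det (mxsub shift2 shift2 A).
  rewrite /cofactor /= expr1 !mulN1r -opprD; congr (- _).
  have -> : row' o (col' ord0 (A + s *: delta_mx ord0 o)) =
     row' o (col' ord0 A) + s *: delta_mx ord0 ord0.
    apply/matrixP=> p q; rewrite !mxE; congr (_ + s * (nat_of_bool _)%:R).
    case: (unliftP ord0 p) => [p'|] ->; case: (unliftP ord0 q) => [q'|] -> //.
  rewrite det_add_delta; congr (_ + _ * _).
  rewrite /cofactor expr0 mul1r; congr (\det _); apply/matrixP=> p q.
  by rewrite !mxE; congr (A _ _); apply: val_inj.
have detE s : \det (A + s *: J) = \det A + s * cofactor A ord0 o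
    - s * (cofactor A o ord0 - s * \det (mxsub shift2 shift2 A)).
  rewrite /J scalerBr addrA -scaleNr det_add_delta cofE det_add_delta.
  by rewrite mulNr.
have := detE 1; rewrite scale1r => ->.
have := detE (-1); rewrite scaleN1r => ->.
by ring.
Qed.

(** Linear spaces of functions as predicates; closure under [=1] stands in for functional
    extensionality. The zero function arises from any member with [a = -1]. *)
Definition lin_closed {F : fieldType} {T : Type} (U : (T -> F) -> Prop) :=
  (forall f g a, U f -> U g -> U (fun t => a * f t + g t)) /\
  (forall f g, f =1 g -> U f -> U g).

(** Allowing every skew shift [w] makes the property pass to principal submatrices and leaves room
    for polarization. *)
Definition det_in {F : fieldType} {T : Type} (U : (T -> F) -> Prop) {n}
    (z : T -> 'M[F]_n) :=
  forall w, skewsym w -> U (fun t => \det (w + z t)).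

Section Compression.
Context {F : fieldType} {T : Type} {U : (T -> F) -> Prop}.
Hypothesis (hchar : 2%N \notin [pchar F]) (hU : lin_closed U).

Lemma two_neq0 : 2%:R != 0 :> F.
Proof. by move: hchar; rewrite inE. Qed.

Lemma det_in_perm n (z : T -> 'M[F]_n) (s : 'S_n) :
  det_in U z -> det_in U (fun t => mxsub s s (z t)).
Proof.
move=> hz w hw; have hw' : skewsym (mxsub s^-1 s^-1 w)%g.
  apply/matrixP=> i j; rewrite !mxE.
  by have /matrixP/(_ ((s^-1)%g i) ((s^-1)%g j)) := hw; rewrite !mxE.
apply: hU.2 (hz _ hw') => t.
have -> : w + mxsub s s (z t) = row_perm s (col_perm s (mxsub s^-1 s^-1 w + z t)%g).
  by apply/matrixP=> i j; rewrite !mxE !permK.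
rewrite row_permE col_permE !det_mulmx !det_perm odd_permV mulrC -mulrA -expr2.
by rewrite sqrr_sign mulr1.
Qed.

Lemma det_in_shift2 n (z : T -> 'M[F]_n.+2) :
  det_in U z -> det_in U (fun t => mxsub shift2 shift2 (z t)).
Proof.
move=> hz w hw.
pose J : 'M[F]_n.+2 := delta_mx ord0 (lift ord0 ord0) - delta_mx (lift ord0 ord0) ord0.
have hJ : skewsym J by rewrite /skewsym /J linearB /= !trmx_delta opprB.
pose w' : 'M[F]_n.+2 := @block_mx F 2 n 2 n 0 0 0 w.
have hw' : skewsym w'.
  by rewrite /skewsym /w' (@tr_block_mx _ 2 n 2 n) (@opp_block_mx _ 2 n 2 n) hw !trmx0 !oppr0.
have w'E i j : w' (shift2 i) (shift2 j) = w i j.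
  have -> : shift2 i = rshift 2 i by apply: val_inj.
  have -> : shift2 j = rshift 2 j by apply: val_inj.
  exact: (@block_mxEdr _ 2 n 2 n 0 0 0 w i j).
have sub t : w + mxsub shift2 shift2 (z t) = mxsub shift2 shift2 (w' + z t).
  apply/matrixP=> i j; rewrite mxE [mxsub _ _ (z t) _ _]mxE.
  by rewrite [RHS]mxE [RHS]mxE w'E.
have skD (a b : 'M[F]_n.+2) : skewsym a -> skewsym b -> skewsym (a + b).
  by rewrite /skewsym linearD /= opprD => -> ->.
have skN (a : 'M[F]_n.+2) : skewsym a -> skewsym (- a).
  by rewrite /skewsym linearN /= => ->.
have h1 := hz _ (skD _ _ hw' hJ).
have h2 := hz _ (skD _ _ hw' (skN _ hJ)).
have h0 := hz _ hw'.
(* Half the second difference. Since [lin_closed] only forms [a * f + g], the last coefficient 1/2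
   is split as (1/2 - 1) + 1. *)
have h := hU.1 _ _ (2%:R^-1) h1 (hU.1 _ _ (-1) h0 (hU.1 _ _ (2%:R^-1 - 1) h2 h2)).
apply: hU.2 h => t /=.
apply: (mulfI two_neq0).
rewrite sub -det_second_difference -/J [w' + J + _]addrAC [w' - J + _]addrAC.
by field; exact: two_neq0.
Qed.

Lemma perm_sending2 n (a b : 'I_n.+2) : a != b ->
  exists s : 'S_n.+2, s ord0 = a /\ s (lift ord0 ord0) = b.
Proof.
move=> ab; pose o : 'I_n.+2 := lift ord0 ord0.
exists (tperm o (tperm ord0 a b) * tperm ord0 a)%g; rewrite !permM; split.
  rewrite [tperm o _ _]tpermD ?tpermL //.
  by rewrite -(inj_eq (@perm_inj _ (tperm ord0 a))) tpermK tpermL eq_sym.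
by rewrite tpermL tpermK.
Qed.

(** Each of the [m] rounds permutes two indices missed by [f] to the front and deletes them. *)
Lemma det_in_mxsub m k n (f : 'I_k -> 'I_n) (z : T -> 'M[F]_n) :
  n = (m.*2 + k)%N -> injective f -> det_in U z ->
  det_in U (fun t => mxsub f f (z t)).
Proof.
elim: m n f z => [|m IH] n f z.
  rewrite add0n => en; subst n => finj hz.
  have := det_in_perm _ _ (perm finj) hz.
  move=> h w /h; apply: hU.2 => t; congr (\det (_ + _)).
  by apply/matrixP=> i j; rewrite !mxE !permE.
rewrite doubleS !addSn => en; subst n => finj hz.
have : (1 < #|[predC codom f]|)%N.
  have := cardC (mem (codom f)); rewrite (card_codom finj) !card_ord => e.
  rewrite -(ltn_add2l k) e; lia.
case/card_gt1P=> a [b] [/= ha hb ab].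
have [s [s0 s1]] := perm_sending2 _ _ _ ab.
have fP i : exists i', f i == s (shift2 i').
  have : f i != a by apply: contraNneq ha => <-; apply: codom_f.
  have : f i != b by apply: contraNneq hb => <-; apply: codom_f.
  have -> : f i = s ((s^-1)%g (f i)) by rewrite permKV.
  move: ((s^-1)%g (f i)) => x.
  rewrite -s1 -s0 !(inj_eq perm_inj).
  case: (unliftP ord0 x) => [x'|] ->; last by rewrite eqxx.
  rewrite (inj_eq lift_inj).
  case: (unliftP ord0 x') => [x''|] ->; last by rewrite eqxx.
  by move=> _ _; exists x''; rewrite /shift2.
pose f' i := xchoose (fP i).
have f'E i : f i = s (shift2 (f' i)) by exact: (eqP (xchooseP (fP i))).
have f'inj : injective f' by move=> i j e; apply: finj; rewrite !f'E e.
have := IH _ f' _ erefl f'inj (det_in_shift2 _ _ (det_in_perm _ _ s hz)).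
move=> h w /h; apply: hU.2 => t; congr (\det (_ + _)).
by apply/matrixP=> i j; rewrite !mxE !f'E.
Qed.
End Compression.

(** For skew [x] and distinct indices, the Pfaffian of the principal submatrix on [i, j, k, l]; its
    vanishing is a Plücker relation. *)
Definition pf4 {F : fieldType} {n} (x : 'M[F]_n) (i j k l : 'I_n) : F :=
  x i j * x k l - x i k * x j l + x i l * x j k.

Section SkewEntries.
Context {F : fieldType}.
Hypothesis hchar : 2%N \notin [pchar F].

Lemma skew_opp n (x : 'M[F]_n) i j : skewsym x -> x j i = - x i j.
Proof. by move=> /matrixP/(_ i j); rewrite !mxE. Qed.

Lemma skew_diag n (x : 'M[F]_n) i : skewsym x -> x i i = 0.
Proof.
move=> hx; have /eqP := skew_opp _ _ i i hx.
by rewrite -addr_eq0 -mulr2n -mulr_natr mulf_eq0 (negbTE (two_neq0 hchar)) orbF => /eqP.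
Qed.

Lemma skew_mxsub n k (f : 'I_k -> 'I_n) (x : 'M[F]_n) :
  skewsym x -> skewsym (mxsub f f x).
Proof. by move=> hx; apply/matrixP=> i j; rewrite !mxE skew_opp. Qed.

Lemma det_skew2 (x : 'M[F]_2) : skewsym x -> \det x = x ord0 (lift ord0 ord0) ^+ 2.
Proof.
move=> hx; rewrite (expand_det_row _ ord0) !big_ord_recl big_ord0 /cofactor !det_mx11 !mxE /=.
rewrite skew_diag // mul0r add0r addr0 expr1.
have -> : lift (lift ord0 ord0) 0 = 0 :> 'I_2 by apply: val_inj.
by rewrite (skew_opp _ _ 0) // mulrNN mul1r.
Qed.

Lemma det_skew4 (x : 'M[F]_4) : skewsym x ->
  \det x = pf4 x (inord 0) (inord 1) (inord 2) (inord 3) ^+ 2.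
Proof.
(* Indexing by natural numbers lets the nested lifts of the cofactor expansion reduce by
   computation. *)
move=> hx; pose g a b := x (inord a) (inord b).
have gD a : g a a = 0 by apply: skew_diag.
have gN a b : g b a = - g a b by apply: skew_opp.
have -> : \det x = \det (\matrix_(i < 4, j < 4) g i j).
  by congr (\det _); apply/matrixP=> i j; rewrite mxE /g !inord_val.
rewrite /pf4 -/(g 0 1) -/(g 2 3) -/(g 0 2) -/(g 1 3) -/(g 0 3) -/(g 1 2).
do 3!rewrite !(expand_det_row _ ord0) !big_ord_recl !big_ord0 /cofactor.
rewrite !det_mx11 !mxE /= /bump /= !addn0 !add1n !gD.
rewrite (gN 0 1) (gN 0 2) (gN 0 3) (gN 1 2) (gN 1 3) (gN 2 3).
by ring.
Qed.
End SkewEntries.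

Section Entries.
Context {F : fieldType} {T : Type} {U : (T -> F) -> Prop}.
Hypothesis (hchar : 2%N \notin [pchar F]) (hU : lin_closed U).

(** For [i != j], the 2 by 2 principal minor at [i, j], shifted by [c *: J], is
    [(z t i j + c) ^+ 2]. Taking [c = 0] gives the square, and the difference of [c = 1] and
    [c = -1] is four times the entry. *)
Lemma det_in_entry n (z : T -> 'M[F]_n) i j :
  ~~ odd n -> (forall t, skewsym (z t)) -> det_in U z ->
  U (fun t => z t i j) /\ U (fun t => z t i j ^+ 2).
Proof.
move=> hn hz hG; have [->|ij] := eqVneq i j.
  have h0 : U (fun=> 0).
    have h : U (fun t => \det (0 + z t)).
      by apply: hG; rewrite /skewsym trmx0 oppr0.
    by apply: hU.2 (hU.1 _ _ (-1) h h) => t; rewrite mulN1r addNr.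
  by split; apply: hU.2 h0 => t; rewrite skew_diag // expr0n.
pose f (k : 'I_2) := if k == ord0 then i else j.
have finj : injective f.
  move=> a b; rewrite /f.
  case: (unliftP ord0 a) => [a'|] ->; case: (unliftP ord0 b) => [b'|] -> //=.
  - by rewrite !ord1.
  - by move/eqP; rewrite eq_sym (negbTE ij).
  - by move/eqP; rewrite (negbTE ij).
have en : n = ((n./2).-1.*2 + 2)%N.
  have n2 : (1 < n)%N.
    case: n i j ij {f finj z hz hG hn} => [|[|n]] i j //; first by case: i.
    by rewrite (ord1 i) (ord1 j) eqxx.
  by lia.
have h := det_in_mxsub hchar hU _ _ _ f z en finj hG.
pose J : 'M[F]_2 := delta_mx ord0 (lift ord0 ord0) - delta_mx (lift ord0 ord0) ord0.
have hJ : skewsym J by rewrite /skewsym /J linearB /= !trmx_delta opprB.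
have hc c : U (fun t => (z t i j + c) ^+ 2).
  have hcJ : skewsym (c *: J) by rewrite /skewsym linearZ /= hJ scalerN.
  apply: hU.2 (h _ hcJ) => t /=.
  rewrite det_skew2 //.
    by rewrite !mxE /f /= subr0 mulr1 addrC.
  by rewrite /skewsym linearD /= hcJ (skew_mxsub _ _ f _ (hz t)) opprD.
split; last by apply: hU.2 (hc 0) => t; rewrite addr0.
have two := two_neq0 hchar.
have h1 := hU.1 _ _ (2%:R^-1 * 2%:R^-1) (hc 1)
  (hU.1 _ _ (- (2%:R^-1 * 2%:R^-1)-1) (hc (-1)) (hc (-1))).
by apply: hU.2 h1 => t /=; field.
Qed.
End Entries.

(** An instance of [det_in_entry]: [a] and [b] form a family indexed by [bool], and [U] consists of
    the functions with equal values at both booleans. *)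
Lemma skew_eq_of_det {F : fieldType} n (a b : 'M[F]_n) :
  2%N \notin [pchar F] -> ~~ odd n -> skewsym a -> skewsym b ->
  (forall w, skewsym w -> \det (w + a) = \det (w + b)) -> a = b.
Proof.
move=> hchar hn ha hb hab.
pose U (f : bool -> F) := f true = f false.
have hU : lin_closed U.
  by split=> [f g c|f g fg]; rewrite /U; [move=> -> ->|rewrite !fg].
pose z (t : bool) := if t then a else b.
apply/matrixP=> i j.
by have [] := det_in_entry hchar hU _ z i j hn (fun t => if t is true then ha else hb) hab.
Qed.

(** * Polynomial functions and rank 2 lines *)

(** Here [m] bounds the size, so the degree is below [m]: [poly_fun 3] means at most quadratic. *)
Definition poly_fun {F : fieldType} (m : nat) (f : F -> F) :=
  exists2 p : {poly F}, (size p <= m)%N & forall t, f t = p.[t].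

Lemma poly_fun_lin_closed (F : fieldType) m : lin_closed (@poly_fun F m).
Proof.
split=> [f g a [p sp fp] [q sq gq]|f g fg [p sp fp]].
  exists (a *: p + q); last by move=> t; rewrite hornerD hornerZ fp gq.
  rewrite (leq_trans (size_polyD _ _)) // geq_max sq andbT.
  exact: leq_trans (size_scale_leq _ _) sp.
by exists p => // t; rewrite -fg.
Qed.

Lemma poly_eq_of_card (F : fieldType) m (p q : {poly F}) :
  card_ge F m -> (size p <= m)%N -> (size q <= m)%N ->
  (forall t, p.[t] = q.[t]) -> p = q.
Proof.
move=> [s [us ss]] sp sq e; apply/eqP; rewrite -subr_eq0.
apply: contraTT isT => /max_poly_roots h.
have := h s; rewrite us ss => /(_ _ isT).
have -> : all (root (p - q)) s.
  by apply/allP=> t _; rewrite rootE hornerD hornerN e subrr.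
move=> /(_ isT); rewrite ltnNge => /negP[].
by rewrite (leq_trans (size_polyD _ _)) // size_polyN geq_max sp.
Qed.

Lemma card_ge_leq (F : fieldType) m k : (k <= m)%N -> card_ge F m -> card_ge F k.
Proof.
move=> km [s [us ss]]; exists (take k s); rewrite take_uniq // size_take ss.
by split=> //; case: ltngtP km.
Qed.

Section Lines.
Context {F : fieldType} {n : nat}.
Hypotheses (hchar : 2%N \notin [pchar F]) (hn : ~~ odd n) (hF : card_ge F 5).

(* Both [z i j] and its square are given by polynomials of degree at most 2, which
   forces degree at most 1 as soon as the field has 5 elements. *)
Lemma quadratic_det_affine (z : F -> 'M[F]_n) : (forall t, skewsym (z t)) ->
  det_in (poly_fun 3) z -> forall t, z t = z 0 + t *: (z 1 - z 0).
Proof.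
move=> hz hG t; apply/matrixP=> i j; rewrite !mxE.
have [[p sp pE] [q sq qE]] :=
  det_in_entry hchar (poly_fun_lin_closed F 3) _ z i j hn hz hG.
have epq : p ^+ 2 = q.
  apply: (poly_eq_of_card _ 5 _ _ hF).
  - by rewrite expr2 (leq_trans (size_polyMleq _ _)) //; lia.
  - by apply: leq_trans sq _.
  - by move=> s; rewrite horner_exp -pE -qE.
have {}sp : (size p <= 2)%N.
  have [->|p0] := eqVneq p 0; first by rewrite size_poly0.
  have : ((size q).-1 <= 2)%N by case: (size q) sq.
  by rewrite -epq size_exp; case: (size p) => [|[|[|]]].
have pE' s : z s i j = p`_0 + p`_1 * s.
  rewrite pE (horner_coef_wide _ sp) !big_ord_recl big_ord0 addr0.
  by rewrite expr0 mulr1 expr1.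
by rewrite !pE'; ring.
Qed.

(** For distinct indices, the shift by the negated submatrix of [a] leaves the minor
    [t ^+ 4 * pf4 q i j k l ^+ 2], which can have degree at most 2 only if it vanishes. With a
    repeated index, [pf4] is zero on every skew matrix. *)
Lemma quadratic_det_pf4 (a q : 'M[F]_n) : skewsym a -> skewsym q ->
  det_in (poly_fun 3) (fun t => a + t *: q) -> forall i j k l, pf4 q i j k l = 0.
Proof.
move=> ha hq hG i j k l.
have [ui|] := boolP (uniq [:: i; j; k; l]); last first.
  rewrite /= !inE !negb_or !negb_and !negbK ?orbF.
  have S x y := skew_opp _ _ x y hq; have D x := skew_diag hchar _ _ x hq.
  rewrite /pf4.
  case/or3P=> [/or3P[]|/orP[]|] /eqP<-; rewrite !D.
  - by ring.
  - by rewrite (S i j); ring.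
  - by rewrite (S i j) (S i k); ring.
  - by ring.
  - by rewrite (S j k); ring.
  - by ring.
pose f (s : 'I_4) := nth i [:: i; j; k; l] s.
have finj : injective f.
  move=> s t /eqP; rewrite /f nth_uniq ?ltn_ord //.
  by move=> /eqP/val_inj.
have n4 : (4 <= n)%N by have := leq_card _ finj; rewrite !card_ord.
have en : n = ((n./2 - 2).*2 + 4)%N by move: hn; lia.
have hs : skewsym (- mxsub f f a) by rewrite /skewsym linearN /= (skew_mxsub _ _ f _ ha).
have [p sp pE] := det_in_mxsub hchar (poly_fun_lin_closed F 3) _ _ _ f _ en finj hG _ hs.
have e : p = (\det (mxsub f f q)) *: 'X^4.
  apply: (poly_eq_of_card _ 5 _ _ hF).
  - by apply: leq_trans sp _.
  - by apply: leq_trans (size_scale_leq _ _) _; rewrite size_polyXn.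
  move=> t; rewrite -pE hornerZ hornerXn.
  have -> : - mxsub f f a + mxsub f f (a + t *: q) = t *: mxsub f f q.
    by apply/matrixP=> x y; rewrite !mxE addKr.
  by rewrite detZ mulrC.
have : \det (mxsub f f q) = 0.
  have := congr1 (fun r : {poly F} => r`_4) e.
  by rewrite coefZ coefXn eqxx mulr1 nth_default // (leq_trans sp).
rewrite det_skew4 //; last exact: skew_mxsub.
move=> /eqP; rewrite expf_eq0 /= => /eqP.
by rewrite /pf4 !mxE /f !inordK.
Qed.
End Lines.

(** If [q i j != 0], the Plücker relation at [i, j, k, l] solves for [q k l] and exhibits [q] as the
    wedge of row [i] with row [j] divided by [q i j]. *)
Lemma rank_le2_of_pf4 (F : fieldType) n (q : 'M[F]_n) : skewsym q ->
  (forall i j k l, pf4 q i j k l = 0) -> (\rank q <= 2)%N.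
Proof.
move=> hq hpf; have [->|/matrix0Pn[i [j qij]]] := eqVneq q 0; first by rewrite mxrank0.
pose e := row i q; pose f := (q i j)^-1 *: row j q.
have -> : q = e^T *m f + (- f)^T *m e.
  apply/matrixP=> k l; rewrite !mxE !big_ord1 !mxE.
  apply: (mulfI qij); have /eqP := hpf i j k l.
  rewrite /pf4 addrAC subr_eq0 -subr_eq0 => /eqP h.
  by rewrite -[LHS]subr0 -h; field.
rewrite (leq_trans (mxrank_add _ _)) // (@leq_add _ _ 1 1) //; exact: mulmx_max_rank.
Qed.

(** At most [r] rows contain the variable, each in one entry and to the first power, so every
    Leibniz term has degree at most [r]. *)
Lemma poly_fun_det_add_pid (F : fieldType) n r (A : 'M[F]_n) :
  poly_fun r.+1 (fun t => \det (A + t *: pid_mx r)).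
Proof.
pose P := map_mx polyC A + 'X *: pid_mx r.
exists (\det P) => [|t]; last first.
  rewrite -[RHS]/(horner_eval t (\det P)) -det_map_mx; congr (\det _); apply/matrixP=> i j.
  by rewrite !mxE /= /horner_eval !hornerE -polyC_natr hornerC.
apply: leq_trans (size_sum _ _ _) _; apply/bigmax_leqP => s _.
rewrite -signr_odd mulr_sign.
have -> (b : bool) (x : {poly F}) : size (if b then - x else x) = size x.
  by case: b; rewrite ?size_polyN.
apply: leq_trans (size_poly_prod_leq _ _) _.
rewrite (@eq_card _ _ 'I_n) // card_ord leq_subLR.
have sum_le m : (\sum_(i < m) (i < r) <= minn m r)%N.
  elim: m => [|m IH]; first by rewrite big_ord0.
  rewrite big_ord_recr /= (leq_trans (leq_add IH (leqnn _))) //.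
  by case: (ltnP m r) => /=; lia.
have : (\sum_i size (P i (s i)) <= \sum_(i < n) (1 + (i < r)))%N.
  apply: leq_sum => i _; rewrite !mxE (leq_trans (size_polyD _ _)) //.
  rewrite geq_max (leq_trans (size_polyC_leq1 _)) //=.
  case: (i < r)%N; rewrite ?andbF ?mulr0 ?size_poly0 // andbT.
  by case: (_ == _); rewrite ?mulr1 ?mulr0 ?size_poly0 ?size_polyX.
rewrite big_split /= sum1_card card_ord => h.
by rewrite addnS ltnS (leq_trans h) // leq_add2l (leq_trans (sum_le n)) // geq_minr.
Qed.

(** Multiplying by invertible matrices on both sides reduces [v] to [pid_mx (\rank v)]. *)
Lemma poly_fun_det_line (F : fieldType) n r (A v : 'M[F]_n) :
  (\rank v <= r)%N -> poly_fun r.+1 (fun t => \det (A + t *: v)).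
Proof.
move=> hv; pose L := col_ebase v; pose R := row_ebase v.
have [p sp pE] := poly_fun_det_add_pid F n (\rank v) (invmx L *m A *m invmx R).
exists ((\det L * \det R) *: p).
  by rewrite (leq_trans (size_scale_leq _ _)) // (leq_trans sp).
move=> t; rewrite hornerZ -pE mulrAC -!det_mulmx; congr (\det _).
rewrite mulmxDr mulmxDl !mulmxA mulmxV ?col_ebase_unit // mul1mx.
rewrite -!mulmxA mulVmx ?row_ebase_unit // mulmx1; congr (_ + _).
by rewrite -scalemxAl -scalemxAr mulmxA mulmx_ebase.
Qed.

(** * Expanding [\det (w + psi y)] in the functions [\det (x + y)] *)

Section Gram.
Context {F : fieldType} {n : nat}.

Definition gram {r s} (x : 'I_r -> 'M[F]_n) (y : 'I_s -> 'M[F]_n) : 'M[F]_(r, s) :=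
  \matrix_(i, j) \det (x i + y j).

Lemma rank_gram_bounded : exists N, forall r s (x : 'I_r -> 'M[F]_n) (y : 'I_s -> 'M[F]_n),
  (\rank (gram x y) <= N)%N.
Proof.
(* Leibniz formula with each factor [x i a (s a) + y j a (s a)] expanded. *)
pose K : finType := ('S_n * {ffun 'I_n -> bool})%type.
exists #|{: K}| => r s x y; pose ev (k : 'I_#|{: K}|) : K := enum_val k.
pose P : 'M[F]_(r, #|{: K}|) := \matrix_(i, k)
  ((-1) ^+ (ev k).1 * \prod_(a | (ev k).2 a) x i a ((ev k).1 a)).
pose Q : 'M[F]_(#|{: K}|, s) := \matrix_(k, j)
  \prod_(a | ~~ (ev k).2 a) y j a ((ev k).1 a).
suff -> : gram x y = P *m Q by apply: mulmx_max_rank.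
apply/matrixP=> i j; rewrite !mxE /determinant.
transitivity (\sum_(k : K) (-1) ^+ k.1 * \prod_(a | k.2 a) x i a (k.1 a) *
    \prod_(a | ~~ k.2 a) y j a (k.1 a)).
  rewrite -(pair_bigA _ (fun (s : 'S_n) (f : {ffun 'I_n -> bool}) =>
    (-1) ^+ s * \prod_(a | f a) x i a (s a) * \prod_(a | ~~ f a) y j a (s a))) /=.
  apply: eq_bigr => u _.
  transitivity ((-1) ^+ u * \prod_a \sum_(b : bool) (if b then x i a (u a) else y j a (u a))).
    by congr (_ * _); apply: eq_bigr => a _; rewrite big_bool !mxE.
  rewrite bigA_distr_bigA big_distrr /=; apply: eq_bigr => f _; rewrite -mulrA; congr (_ * _).
  rewrite (bigID f) /=; congr (_ * _); apply: eq_bigr => a; first by move->.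
  by move/negbTE->.
rewrite (reindex ev); last exact/onW_bij/enum_val_bij.
by apply: eq_bigr => k _; rewrite !mxE.
Qed.

(** Block elimination: the Schur complement of [M] is 1 by 1, so it must vanish when the bordered
    matrix is singular. *)
Lemma schur_unitmx r (M : 'M[F]_r) (c : 'cV_r) (b : 'rV_r) (s : 'M_1) :
  M \in unitmx -> block_mx M c b s \notin unitmx -> s = b *m invmx M *m c.
Proof.
move=> uM; apply: contraNeq => ne.
have -> : block_mx M c b s =
    block_mx 1%:M 0 (b *m invmx M) 1%:M *m block_mx M c 0 (s - b *m invmx M *m c).
  rewrite mulmx_block !mul1mx !mul0mx !addr0 -(mulmxA b) mulVmx // mulmx1.
  by rewrite addrC subrK.
rewrite unitmxE det_mulmx det_lblock det_ublock !det1 !mul1r unitrM -unitmxE uM /=.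
rewrite det_mx11 unitfE; apply: contraNneq ne => h.
by rewrite -subr_eq0; apply/eqP/matrixP=> i j; rewrite !ord1 h mxE.
Qed.
End Gram.

Lemma max_prop (P : nat -> Prop) N : P 0%N -> (forall r, P r -> (r <= N)%N) ->
  exists2 r, P r & ~ P r.+1.
Proof.
move=> P0 PN; apply: NNPP => h.
have Pall r : P r by elim: r => // r Pr; apply: NNPP => h'; apply: h; exists r.
by have := PN N.+1 (Pall _); rewrite ltnn.
Qed.

(** Border an invertible Gram matrix of maximal size by a row for [w] and a column for [psi z]. The
    result is singular, so its corner is [b *m invmx M *m c], where only [c] depends on [z]. *)
Lemma det_expansion (F : fieldType) n (phi psi : 'M[F]_n -> 'M[F]_n) :
  (forall x, skewsym x -> skewsym (phi x)) ->
  (forall x, skewsym x -> skewsym (psi x)) ->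
  (forall x y, skewsym x -> skewsym y -> \det (phi x + psi y) = \det (x + y)) ->
  forall w, skewsym w -> exists r (lam : 'I_r -> F) (x : 'I_r -> 'M[F]_n),
    (forall i, skewsym (x i)) /\
    forall y, skewsym y -> \det (w + psi y) = \sum_i lam i * \det (x i + y).
Proof.
move=> hphi hpsi hdet w hw.
pose P r := exists (x y : 'I_r -> 'M[F]_n),
  [/\ forall i, skewsym (x i), forall i, skewsym (y i) & gram x y \in unitmx].
have [N hN] := @rank_gram_bounded F n.
have [||r [x [y [hx hy hM]]] hmax] := max_prop P N.
- by exists (fun=> 0), (fun=> 0); split=> [[]|[]|] //; rewrite unitmxE det_mx00 unitr1.
- by move=> r [x [y [_ _ /mxrank_unit <-]]]; apply: hN.
pose b : 'rV[F]_r := \row_j \det (w + psi (y j)).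
exists r, (fun i => (b *m invmx (gram x y)) 0 i), x; split=> // z hz.
(* Since [w] need not be a value of [phi], the families are bordered after applying the maps; [hdet]
   then removes the maps from the two upper blocks. *)
pose x' (i : 'I_(r + 1)) := if split i is inl a then phi (x a) else w.
pose y' (i : 'I_(r + 1)) := if split i is inl a then psi (y a) else psi z.
pose c : 'cV[F]_r := \col_i \det (x i + z).
have e : gram x' y' = block_mx (gram x y) c b (\det (w + psi z))%:M.
  apply/matrixP=> i j; rewrite -(splitK i) -(splitK j) /x' /y'.
  case: (split i) => i'; case: (split j) => j' /=;
    rewrite ?block_mxEul ?block_mxEur ?block_mxEdl ?block_mxEdr mxE.
  - by rewrite !(unsplitK (inl _)) mxE hdet.
  - by rewrite (unsplitK (inl _)) (unsplitK (inr _)) mxE hdet.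
  - by rewrite (unsplitK (inl _)) (unsplitK (inr _)) mxE.
  - by rewrite !(unsplitK (inr _)) !ord1 mxE.
have /schur_unitmx -/(_ hM) : block_mx (gram x y) c b (\det (w + psi z))%:M \notin unitmx.
  rewrite -e; apply/negP=> u; apply: hmax; rewrite -addn1; exists x', y'; split=> // i.
    by rewrite /x'; case: (split i) => a //; apply: hphi.
  by rewrite /y'; case: (split i) => a; apply: hpsi.
move=> /matrixP/(_ 0 0); rewrite mxE eqxx mulr1n => ->.
by rewrite mxE; apply: eq_bigr => i _; rewrite [c _ _]mxE.
Qed.

(** * Skew matrices, wedges and Plücker relations *)

Section SkewModule.
Context {F : fieldType} {n : nat}.
Implicit Types (u v w x y : 'M[F]_n) (e f g h : 'rV[F]_n).

Lemma skew0 : skewsym (0 : 'M[F]_n).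
Proof. by rewrite /skewsym trmx0 oppr0. Qed.

Lemma skewD x y : skewsym x -> skewsym y -> skewsym (x + y).
Proof. by rewrite /skewsym linearD /= opprD => -> ->. Qed.

Lemma skewZ a x : skewsym x -> skewsym (a *: x).
Proof. by rewrite /skewsym linearZ /= => ->; rewrite scalerN. Qed.

Lemma skewN x : skewsym x -> skewsym (- x).
Proof. by rewrite /skewsym linearN /= => ->. Qed.

Lemma skewB x y : skewsym x -> skewsym y -> skewsym (x - y).
Proof. by move=> hx /skewN; apply: skewD. Qed.

(* By the Plücker relations, these are the skew matrices of rank at most 2. *)
Definition thin v := skewsym v /\ forall i j k l, pf4 v i j k l = 0.

Definition wedge e f : 'M[F]_n := e^T *m f - f^T *m e.

Lemma wedgeE e f i j : wedge e f i j = e 0 i * f 0 j - f 0 i * e 0 j.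
Proof. by rewrite !mxE !big_ord1 !mxE. Qed.

Lemma thin_wedge e f : thin (wedge e f).
Proof.
split; first by apply/matrixP=> i j; rewrite mxE [RHS]mxE !wedgeE; ring.
by move=> i j k l; rewrite /pf4 !wedgeE; ring.
Qed.

Lemma wedgeC e f : wedge f e = - wedge e f.
Proof. by rewrite /wedge opprB. Qed.

Lemma wedgeDl e f g : wedge (e + f) g = wedge e g + wedge f g.
Proof. by apply/matrixP=> i j; rewrite [RHS]mxE !wedgeE !mxE; ring. Qed.

Lemma wedgeDr e f g : wedge e (f + g) = wedge e f + wedge e g.
Proof. by apply/matrixP=> i j; rewrite [RHS]mxE !wedgeE !mxE; ring. Qed.

Definition unit_wedge (i j : 'I_n) := wedge (delta_mx 0 i) (delta_mx 0 j).

Lemma unit_wedgeE i j a b :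
  unit_wedge i j a b = ((a == i) && (b == j))%:R - ((a == j) && (b == i))%:R.
Proof. by rewrite wedgeE !mxE -!natrM !mulnb. Qed.

(** Summing over all ordered pairs [(i, j)] counts each entry twice, hence the factor 1/2 in the
    decomposition. *)
Lemma skew_ind (K : 'M[F]_n -> Prop) : 2%N \notin [pchar F] ->
  K 0 -> (forall x y, K x -> K y -> K (x + y)) ->
  (forall a i j, K (a *: unit_wedge i j)) -> forall x, skewsym x -> K x.
Proof.
move=> hchar K0 KD KE x hx.
have -> : x = \sum_i \sum_j (2%:R^-1 * x i j) *: unit_wedge i j.
  apply/matrixP=> a b; rewrite summxE.
  rewrite (eq_bigr (fun i => 2%:R^-1 * (x i b *+ (a == i) - x i a *+ (b == i)))); last first.
    move=> i _; rewrite summxE.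
    rewrite (eq_bigr (fun j => 2%:R^-1 * (x i j *+ ((a == i) && (b == j)))
      - 2%:R^-1 * (x i j *+ ((a == j) && (b == i))))); last first.
      by move=> j _; rewrite mxE unit_wedgeE mulrBr -!mulrA !mulr_natr.
    rewrite sumrB -!mulr_sumr -mulrBr; congr (_ * (_ - _)).
      rewrite (bigD1 b) //= eqxx andbT big1 ?addr0 // => j /negbTE.
      by rewrite eq_sym => ->; rewrite andbF.
    rewrite (bigD1 a) //= eqxx /= big1 ?addr0 // => j /negbTE.
    by rewrite eq_sym => ->.
  rewrite -mulr_sumr sumrB (bigD1 a) //= eqxx big1 ?addr0; last first.
    by move=> i /negbTE; rewrite eq_sym => ->.
  rewrite (bigD1 b) //= eqxx big1 ?addr0; last first.
    by move=> i /negbTE; rewrite eq_sym => ->.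
  have two := two_neq0 hchar.
  by rewrite (skew_opp _ _ a b hx) !mulr1n; field.
by apply: (big_ind K) => // i _; apply: (big_ind K).
Qed.

(** When [a, b] avoid [i, j], adding the unit wedge changes [pf4 w i j a b] by exactly [w a b], and
    both values of [pf4] are zero. *)
Lemma thin_add_unit_wedge w i j a b : i != j -> thin w -> thin (unit_wedge i j + w) ->
  a != i -> a != j -> b != i -> b != j -> w a b = 0.
Proof.
move=> ij [sw pw] [_ /(_ i j a b)] + ai aj bi bj.
rewrite /pf4 ![(_ + w) _ _]mxE !unit_wedgeE !eqxx (eq_sym j i) (negbTE ij).
rewrite (negbTE ai) (negbTE aj) (negbTE bi) (negbTE bj) /= ?andbF ?subr0 ?add0r.
move=> h; transitivity (0 - pf4 w i j a b); last by rewrite pw subr0.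
by rewrite -h /pf4; ring.
Qed.
End SkewModule.

(** * Maps that are quadratic on rank 2 lines *)

Definition inc {F : fieldType} {n} (psi : 'M[F]_n -> 'M[F]_n) y v := psi (y + v) - psi y.

Definition inc2 {F : fieldType} {n} (psi : 'M[F]_n -> 'M[F]_n) y u v :=
  psi (y + u + v) - psi (y + u) - psi (y + v) + psi y.

(** The consequence of the determinant identity from which linearity is derived, isolated so that it
    can be applied to [psi] and to its inverse alike. *)
Definition tame {F : fieldType} {n} (psi : 'M[F]_n -> 'M[F]_n) :=
  (forall x, skewsym x -> skewsym (psi x)) /\
  forall y v, skewsym y -> skewsym v -> (\rank v <= 2)%N ->
    det_in (poly_fun 3) (fun t => psi (y + t *: v)).

Section Tame.
Context {F : fieldType} {n : nat}.
Hypotheses (hchar : 2%N \notin [pchar F]) (hn : ~~ odd n) (hF : card_ge F 5).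
Implicit Types (u v w x y : 'M[F]_n) (e f g h : 'rV[F]_n).

Section SingleMap.
Context {psi : 'M[F]_n -> 'M[F]_n}.
Hypothesis hpsi : tame psi.

Lemma tame_line y v t : skewsym y -> thin v ->
  psi (y + t *: v) = psi y + t *: inc psi y v.
Proof.
move=> hy [hv pv]; have := hpsi.2 _ _ hy hv (rank_le2_of_pf4 _ _ _ hv pv).
move/(quadratic_det_affine hchar hn hF) => /(_ _ t); rewrite scale0r addr0 scale1r; apply.
by move=> s; apply: hpsi.1; apply/skewD/skewZ.
Qed.

Lemma incZ y v t : skewsym y -> thin v -> inc psi y (t *: v) = t *: inc psi y v.
Proof. by move=> hy hv; rewrite {1}/inc tame_line // addrAC subrr add0r. Qed.

(** The image of the line is itself a line, by [tame_line], so [quadratic_det_pf4] applies to its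
    direction. *)
Lemma thin_inc y v : skewsym y -> thin v -> thin (inc psi y v).
Proof.
move=> hy hv; have sk : skewsym (inc psi y v).
  by apply: skewB; apply: hpsi.1 => //; apply: skewD => //; case: hv.
split=> //; apply: (quadratic_det_pf4 hchar hn hF (psi y)) => //; first exact: hpsi.1.
move=> w hw; have [hv1 pv] := hv.
have := hpsi.2 _ _ hy hv1 (rank_le2_of_pf4 _ _ _ hv1 pv) w hw.
by apply: (poly_fun_lin_closed F 3).2 => t; rewrite tame_line.
Qed.

Lemma inc2C y u v : inc2 psi y u v = inc2 psi y v u.
Proof. by rewrite /inc2 (addrAC y u v) [_ - psi (y + u) - _]addrAC. Qed.

Lemma inc2E y u v : inc2 psi y u v = inc psi (y + v) u - inc psi y u.
Proof. by rewrite inc2C /inc2 /inc opprB -!addrA; congr (_ + (_ + _)); rewrite addrC. Qed.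

(** Affinity gives four midpoint identities: along [u + v] and [v] at [y], along [u] at [y - v], and
    along [v] at [y + u]. Eliminating the values at [y - u - v], [y + u - v] and [y - v] leaves
    twice the claim. *)
Lemma inc2_eq0 y u v : skewsym y -> thin u -> thin v -> thin (u + v) ->
  inc2 psi y u v = 0.
Proof.
move=> hy hu hv huv; have [[su _] [sv _]] := (hu, hv).
have L z x (hz : skewsym z) (hx : thin x) := tame_line z x (-1) hz hx.
have e0 := L _ _ hy huv.
have e1 := L _ _ (skewB _ _ hy sv) hu.
have e2 := L _ _ (skewD _ _ hy su) hv.
have e3 := L _ _ hy hv.
rewrite /inc !scaleN1r in e0 e1 e2 e3.
have r1 : y - v + u = y + u - v by rewrite addrAC.
have r2 : y - (u + v) = y - v - u by rewrite opprD addrA addrAC.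
rewrite r2 e1 r1 e2 e3 in e0.
apply/matrixP=> i j; apply: (mulfI (two_neq0 hchar)).
move/matrixP: e0 => /(_ i j); rewrite /inc2 addrA !mxE => h.
rewrite mulr0; apply/eqP; rewrite -subr_eq0 in h *.
move: h => /eqP; rewrite -subr_eq0 => /eqP h.
by apply/eqP; rewrite -[RHS]h; ring.
Qed.

Lemma inc2D y u u' v : skewsym y -> thin u -> thin u' -> thin (u + u') -> skewsym v ->
  inc2 psi y (u + u') v = inc2 psi y u v + inc2 psi y u' v.
Proof.
move=> hy hu hu' huu hv.
have incD z : skewsym z -> inc psi z (u + u') = inc psi z u + inc psi z u'.
  move=> hz; have := inc2_eq0 z u u' hz hu hu' huu; rewrite /inc2 /inc addrA => h.
  apply/eqP; rewrite -subr_eq0 -[X in _ == X]h; apply/eqP.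
  by apply/matrixP=> i j; rewrite !mxE; ring.
rewrite !inc2E !incD //; first by apply/matrixP=> i j; rewrite !mxE; ring.
exact: skewD.
Qed.

Lemma inc2Z y u v t : skewsym y -> thin u -> skewsym v ->
  inc2 psi y (t *: u) v = t *: inc2 psi y u v.
Proof. by move=> hy hu hv; rewrite !inc2E !incZ -?scalerBr //; apply: skewD. Qed.

Lemma inc2Dr y u v v' : skewsym y -> skewsym u -> thin v -> thin v' -> thin (v + v') ->
  inc2 psi y u (v + v') = inc2 psi y u v + inc2 psi y u v'.
Proof. by move=> *; rewrite inc2C inc2D // !(inc2C _ u). Qed.

(** Two wedges with a common vector add up to a wedge, so [inc2_eq0] applies. *)
Lemma inc2_wedge_shared y e f g h : skewsym y -> (e = g \/ e = h \/ f = g \/ f = h) ->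
  inc2 psi y (wedge e f) (wedge g h) = 0.
Proof.
move=> hy c0; apply: inc2_eq0 => //; try exact: thin_wedge.
case: c0 => [->|[->|[->|->]]].
- by rewrite -wedgeDr; apply: thin_wedge.
- have -> : wedge h f + wedge g h = wedge h (f - g).
    by apply/matrixP=> i j; rewrite mxE !wedgeE !mxE; ring.
  exact: thin_wedge.
- have -> : wedge e g + wedge g h = wedge (e - h) g.
    by apply/matrixP=> i j; rewrite mxE !wedgeE !mxE; ring.
  exact: thin_wedge.
- by rewrite -wedgeDl; apply: thin_wedge.
Qed.

(* Polarization of [inc2 (e ^ (f + g)) ((f + g) ^ h) = 0]. *)
Lemma inc2_wedge_cycle y e f g h : skewsym y ->
  inc2 psi y (wedge e f) (wedge g h) = inc2 psi y (wedge e g) (wedge h f).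
Proof.
move=> hy; have T a b : @thin F n (wedge a b) by apply: thin_wedge.
have S a b : skewsym (@wedge F n a b) := (T a b).1.
have Tr a b c : thin (@wedge F n a b + wedge a c) by rewrite -wedgeDr.
have Tl a b c : thin (@wedge F n a c + wedge b c) by rewrite -wedgeDl.
have : inc2 psi y (wedge e (f + g)) (wedge (f + g) h) = 0.
  by apply: inc2_wedge_shared => //; right; right; left.
rewrite wedgeDr inc2D // wedgeDl !(inc2Dr _ _ (wedge f h)) //.
rewrite (inc2_wedge_shared y e f f h) //; last by right; right; left.
rewrite (inc2_wedge_shared y e g g h) //; last by right; right; left.
rewrite add0r addr0 => /eqP; rewrite addr_eq0 => /eqP->.
by rewrite (wedgeC f h) -(scaleN1r (wedge f h)) [RHS]inc2C inc2Z // [in RHS]inc2C scaleN1r.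
Qed.
End SingleMap.

(** * Linearity of a tame map with tame inverse *)

Section Inverse.
Context {psi psi' : 'M[F]_n -> 'M[F]_n}.
Hypotheses (hpsi : tame psi) (hpsi' : tame psi').
Hypotheses (psiK : forall x, skewsym x -> psi' (psi x) = x)
  (psiK' : forall x, skewsym x -> psi (psi' x) = x).

Lemma inc_inverse y u : skewsym y -> skewsym u -> inc psi' (psi y) (inc psi y u) = u.
Proof.
by move=> hy hu; rewrite /inc (addrC (psi y)) subrK !psiK ?(addrC y) ?addrK //; apply: skewD.
Qed.

Lemma thin_inc2 y u v : skewsym y -> thin u -> thin v -> thin (inc2 psi y u v).
Proof.
move=> hy hu hv; set d := inc2 psi y u v.
(* [b + t d] is thin for all [t], and [pf4] is quadratic. *)
have tb t : thin (inc psi y u + t *: d).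
  have -> : inc psi y u + t *: d = inc psi (y + t *: v) u.
    have := inc2E (psi := psi) y u (t *: v).
    rewrite inc2C inc2Z // 1?inc2C; last by case: hu.
    by move=> ->; rewrite addrC subrK.
  by apply: thin_inc => //; apply/skewD/skewZ => //; case: hv.
split.
  have [s1 _] := tb 1; have [s0 _] := tb 0.
  have -> : d = (inc psi y u + 1 *: d) - (inc psi y u + 0 *: d).
    by rewrite scale1r scale0r addr0 addrAC subrr add0r.
  exact: skewB.
move=> i j k l; apply: (mulfI (two_neq0 hchar)); rewrite mulr0.
set b := inc psi y u in tb.
transitivity (pf4 (b + 1 *: d) i j k l + pf4 (b + -1 *: d) i j k l
    - 2%:R * pf4 (b + 0 *: d) i j k l).
  by rewrite /pf4 !mxE; ring.
by rewrite (tb 1).2 (tb (-1)).2 (tb 0).2 mulr0 subr0 addr0.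
Qed.

(** With [b = inc psi y u] and [d = inc2 psi y u v], the sum [b + d] is [inc psi (y + v) u], so [b],
    [d] and [b + d] are thin. Hence [inc psi' (psi y)] is additive on [b] and [d], sends [b] to [u],
    and keeps the sum thin. *)
Lemma thin_add_inverse_inc2 y u v : skewsym y -> thin u -> thin v ->
  thin (u + inc psi' (psi y) (inc2 psi y u v)).
Proof.
move=> hy hu hv; have [su _] := hu; have [sv _] := hv.
have hd := thin_inc2 _ _ _ hy hu hv; set d := inc2 psi y u v in hd *.
have hb := thin_inc hpsi _ _ hy hu.
have sy := hpsi.1 _ hy.
have e : inc psi y u + d = inc psi (y + v) u by rewrite /d inc2E addrC subrK.
have hbd : thin (inc psi y u + d) by rewrite e; apply: thin_inc => //; apply: skewD.
have := inc2_eq0 hpsi' _ _ _ sy hb hd hbd.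
move=> h; suff -> : u + inc psi' (psi y) d = inc psi' (psi y) (inc psi y u + d).
  by apply: thin_inc.
rewrite -{1}(inc_inverse y u hy su); apply/eqP; rewrite -subr_eq0 -oppr_eq0 -h; apply/eqP.
by rewrite /inc2 /inc !addrA; apply/matrixP=> i j; rewrite !mxE; ring.
Qed.

(** For distinct indices, [inc2_wedge_cycle] and [inc2C] give the same [d] for all three splittings
    of the four indices into pairs. So the pullback [w] of [d] stays thin after adding the unit
    wedge of any of the six pairs; this forces [w = 0], and then [d = 0]. *)
Lemma inc2_unit_wedge y i j k l : skewsym y ->
  inc2 psi y (unit_wedge i j) (unit_wedge k l) = 0.
Proof.
move=> hy; have T a b : @thin F n (unit_wedge a b) by apply: thin_wedge.
have [ui|] := boolP (uniq [:: i; j; k; l]); last first.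
  rewrite /= !inE !negb_or !negb_and !negbK ?orbF.
  have W a : @unit_wedge F n a a = 0 by rewrite /unit_wedge /wedge subrr.
  have D0 u : inc2 psi y 0 u = 0 by rewrite /inc2 addr0 [_ - psi y - _]addrAC subrr add0r addNr.
  case/or3P=> [/or3P[]|/orP[]|] /eqP e.
  - by rewrite e W D0.
  - by apply: inc2_wedge_shared => //; left; rewrite e.
  - by apply: inc2_wedge_shared => //; right; left; rewrite e.
  - by apply: inc2_wedge_shared => //; right; right; left; rewrite e.
  - by apply: inc2_wedge_shared => //; right; right; right; rewrite e.
  - by rewrite e W inc2C D0.
move: ui; rewrite /= !inE !negb_or !andbT => /and3P[/and3P[ij ik il] /andP[jk jl] kl].
set d := inc2 _ _ _ _; pose w : 'M[F]_n := inc psi' (psi y) d.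
have hd : thin d by apply: thin_inc2.
have sy := hpsi.1 _ hy.
have hw : thin w by apply: thin_inc.
have K (a b p q : 'I_n) : d = inc2 psi y (unit_wedge p q) (unit_wedge a b) ->
    thin (unit_wedge p q + w).
  by move=> e; rewrite /w e; apply: thin_add_inverse_inc2.
have d2 : d = inc2 psi y (unit_wedge i k) (unit_wedge l j) by apply: inc2_wedge_cycle.
have d3 : d = inc2 psi y (unit_wedge i l) (unit_wedge j k).
  by rewrite d2; apply: inc2_wedge_cycle.
(* [{a, b}] would be a vertex cover of the complete graph on [{i, j, k, l}]. *)
have w0 : w = 0.
  apply/matrixP=> a b; rewrite [RHS]mxE; apply/eqP; apply: contraT => wab.
  have C (p q : 'I_n) : p != q -> (exists r s, d = inc2 psi y (unit_wedge p q) (unit_wedge r s)) ->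
      [|| a == p, a == q, b == p | b == q].
    move=> pq [r [s e]]; apply: contraNT wab.
    rewrite !negb_or => /and4P[ap aq bp bq].
    by rewrite (thin_add_unit_wedge w p q a b pq hw (K _ _ _ _ e)).
  have c1 := C i j ij (ex_intro _ k (ex_intro _ l erefl)).
  have c2 := C i k ik (ex_intro _ l (ex_intro _ j d2)).
  have c3 := C i l il (ex_intro _ j (ex_intro _ k d3)).
  have c4 : [|| a == k, a == l, b == k | b == l].
    by apply: C => //; exists i, j; rewrite inc2C.
  have c5 : [|| a == l, a == j, b == l | b == j].
    by apply: C; [rewrite eq_sym | exists i, k; rewrite inc2C].
  have c6 : [|| a == j, a == k, b == j | b == k].
    by apply: C => //; exists i, l; rewrite inc2C.
  have D (c p q : 'I_n) : p != q -> ~~ ((c == p) && (c == q)).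
    by apply: contra => /andP[/eqP<- /eqP<-].
  move: (D a _ _ ij) (D a _ _ ik) (D a _ _ il) (D a _ _ jk) (D a _ _ jl) (D a _ _ kl).
  move: (D b _ _ ij) (D b _ _ ik) (D b _ _ il) (D b _ _ jk) (D b _ _ jl) (D b _ _ kl).
  move: c1 c2 c3 c4 c5 c6.
  by case: (a == i); case: (a == j); case: (a == k); case: (a == l);
    case: (b == i); case: (b == j); case: (b == k); case: (b == l).
have : psi' (psi y + d) = psi' (psi y) by apply/eqP; rewrite -subr_eq0 -[_ - _]/w w0.
move/(congr1 psi); rewrite !psiK' //; last by apply: skewD => //; case: hd.
by move=> e; apply: (addrI (psi y)); rewrite addr0.
Qed.

Lemma inc_unit_wedge_const y z i j : skewsym y -> skewsym z ->
  inc psi (z + y) (unit_wedge i j) = inc psi z (unit_wedge i j).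
Proof.
(* The predicate carries skewness because the cases of [skew_ind] do not provide it. *)
move=> hy; move: y hy z i j; pose K y := skewsym y /\ forall z i j, skewsym z ->
  inc psi (z + y) (unit_wedge i j) = inc psi z (unit_wedge i j).
suff KP y : skewsym y -> K y by move=> y /KP[_ h] z i j; apply: h.
have T i j : @thin F n (unit_wedge i j) by apply: thin_wedge.
apply: skew_ind => // [|x y' [sx hx] [sy hy]|a k l].
- by split=> [|z i j _]; [exact: skew0 | rewrite addr0].
- by split=> [|z i j hz]; [exact: skewD | rewrite addrA hy ?hx //; apply: skewD].
split=> [|z i j hz]; first by apply: skewZ; case: (T k l).
apply/eqP; rewrite -subr_eq0 -inc2E inc2C inc2Z //; last by case: (T i j).
by rewrite inc2_unit_wedge // scaler0.
Qed.

(** A second induction, now on the direction: increments along a sum telescope into increments along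
    the summands. *)
Lemma inc_const x y : skewsym x -> skewsym y -> inc psi y x = inc psi 0 x.
Proof.
move=> hx; move: x hx y; pose K x := skewsym x /\ forall y, skewsym y -> inc psi y x = inc psi 0 x.
suff KP x : skewsym x -> K x by move=> x /KP[].
have T i j : @thin F n (unit_wedge i j) by apply: thin_wedge.
have incD y u v : inc psi y (u + v) = inc psi (y + u) v + inc psi y u.
  by rewrite /inc addrA addrA subrK.
apply: skew_ind => // [|u v [su hu] [sv hv]|a k l].
- by split=> [|y _]; [exact: skew0 | rewrite /inc !addr0 !subrr].
- split=> [|y hy]; first exact: skewD.
  rewrite !incD hu // hv; last exact: skewD.
  by rewrite [inc psi (0 + u) v]hv // add0r.
split=> [|y hy]; first by apply: skewZ; case: (T k l).
rewrite !incZ //; last exact: skew0.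
by rewrite -[y in LHS]add0r inc_unit_wedge_const //; exact: skew0.
Qed.

Lemma tame_additive x y : psi 0 = 0 -> skewsym x -> skewsym y ->
  psi (x + y) = psi x + psi y.
Proof.
move=> psi0 hx hy; have := inc_const _ _ hy hx.
by rewrite /inc psi0 subr0 add0r => <-; rewrite addrCA subrr addr0.
Qed.

Lemma tame_homogeneous a x : psi 0 = 0 -> skewsym x -> psi (a *: x) = a *: psi x.
Proof.
move=> psi0 hx; pose K x := skewsym x /\ psi (a *: x) = a *: psi x.
suff: K x by case.
have T i j : @thin F n (unit_wedge i j) by apply: thin_wedge.
have L b i j : psi (b *: unit_wedge i j) = b *: psi (unit_wedge i j).
  have := incZ hpsi 0 (unit_wedge i j) b skew0 (T i j).
  by rewrite /inc psi0 !subr0 !add0r.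
move: x hx; apply: skew_ind => // [|u v [su hu] [sv hv]|b k l].
- by split; [exact: skew0 | rewrite scaler0 psi0 scaler0].
- split; first exact: skewD.
  by rewrite scalerDr !tame_additive ?hu ?hv ?scalerDr //; exact: skewZ.
split; first by apply: skewZ; case: (T k l).
by rewrite scalerA !L scalerA.
Qed.
End Inverse.
End Tame.

(** * Determinant preservers *)

Section Preserver.
Context {F : fieldType} {n : nat} {phi psi : 'M[F]_n -> 'M[F]_n}.
Hypotheses (hphi : forall x, skewsym x -> skewsym (phi x))
  (hpsi : forall x, skewsym x -> skewsym (psi x))
  (hdet : forall x y, skewsym x -> skewsym y -> \det (phi x + psi y) = \det (x + y)).

(** In [det_expansion] the right-hand side is free of [psi], and each of its terms is at most
    quadratic along a direction of rank at most 2. *)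
Lemma preserver_tame : tame psi.
Proof.
split=> // y v hy hv rv w hw.
have [r [lam [x [hx xE]]]] := det_expansion _ _ _ _ hphi hpsi hdet w hw.
apply: (poly_fun_lin_closed F 3).2 (_ : poly_fun 3 (fun t =>
  \sum_(i <- enum 'I_r) lam i * \det (x i + y + t *: v))).
  by move=> t; rewrite big_enum xE; [apply: eq_bigr => i _; rewrite addrA | apply/skewD/skewZ].
elim: (enum 'I_r) => [|i s IH].
  by exists 0; rewrite ?size_poly0 // => t; rewrite big_nil horner0.
have h := (poly_fun_lin_closed F 3).1 _ _ (lam i) (poly_fun_det_line _ _ _ (x i + y) v rv) IH.
by apply: (poly_fun_lin_closed F 3).2 h => t; rewrite big_cons.
Qed.

(** No expansion is required here: [\det (w + psi' z) = \det (phi w + z)] directly. *)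
Lemma preserver_inverse_tame (psi' : 'M[F]_n -> 'M[F]_n) :
  (forall x, skewsym x -> skewsym (psi' x)) ->
  (forall x, skewsym x -> psi (psi' x) = x) -> tame psi'.
Proof.
move=> hpsi' psiK'; split=> // y v hy hv rv w hw.
have := poly_fun_det_line _ _ _ (phi w + y) v rv.
apply: (poly_fun_lin_closed F 3).2 => t.
have hs : skewsym (y + t *: v) by apply/skewD/skewZ.
by rewrite -addrA -{1}(psiK' _ hs) hdet //; apply: hpsi'.
Qed.
End Preserver.

(** Multiplying by ['X] makes the identity hold at [s = 0] too; the size rises to [n.+2], which
    explains the cardinality bound. *)
Lemma det_line_const (F : fieldType) n (z c : 'M[F]_n) d : card_ge F n.+2 ->
  (forall s, s != 0 -> \det (z + s *: c) = d) -> \det z = d.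
Proof.
move=> hF h; have [p sp pE] := poly_fun_det_line F n n z c (rank_leq_row _).
suff /(mulIf (negbT (polyX_eq0 F))) e : p * 'X = d%:P * 'X.
  by have := pE 0; rewrite scale0r addr0 e hornerC.
apply: (poly_eq_of_card _ _ _ _ hF) => [||s].
- by rewrite (leq_trans (size_polyMleq _ _)) // size_polyX addn2.
- by rewrite mul_polyC (leq_trans (size_scale_leq _ _)) // size_polyX.
rewrite !hornerM hornerX hornerC -pE; have [->|s0] := eqVneq s 0; first by rewrite !mulr0.
by rewrite h.
Qed.

Theorem theorem1p4 (F : fieldType) (n : nat)
  (phi psi : 'M[F]_n -> 'M[F]_n)
  (hn_pos : (0 < n)%N) (hn_even : ~~ odd n)
  (hchar : 2%N \notin [pchar F])
  (hcard : card_ge F (n ^ 2).+1)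
  (hphi_Q : forall x : 'M[F]_n, skewsym x -> skewsym (phi x))
  (hpsi_Q : forall x : 'M[F]_n, skewsym x -> skewsym (psi x))
  (hpsi_surj : forall y : 'M[F]_n, skewsym y -> exists2 x, skewsym x & psi x = y)
  (hpsi0 : psi 0 = 0)
  (hdet : forall x y : 'M[F]_n, skewsym x -> skewsym y -> \det (phi x + psi y) = \det (x + y)) :
  (forall x : 'M[F]_n, skewsym x -> phi x = psi x) /\
  (forall x y : 'M[F]_n, skewsym x -> skewsym y -> psi x = psi y -> x = y) /\
  (forall x y : 'M[F]_n, skewsym x -> skewsym y -> psi (x + y) = psi x + psi y) /\
  (forall (a : F) (x : 'M[F]_n), skewsym x -> psi (a *: x) = a *: psi x) /\
  (forall x : 'M[F]_n, skewsym x -> \det (psi x) = \det x).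

Proof.
have hF k : (k <= (n ^ 2).+1)%N -> card_ge F k by move=> /card_ge_leq; apply.
have n2 : (1 < n)%N by move: hn_pos hn_even; rewrite leq_eqVlt => /orP[/eqP<-|].
(* This puts both cardinalities used below, 5 and [n.+2], under [(n ^ 2).+1]. *)
have n4 : (2 * n <= n ^ 2)%N by rewrite -mulnn leq_mul2r n2 orbT.
have F5 : card_ge F 5 by apply: hF; lia.
have sk0 := @skew0 F n.
(* The second disjunct makes the existential unconditional, so that [xchoose]
   gives a total inverse; it is a junk value off the skew matrices. *)
have inv y : exists x, (x^T == - x) && (psi x == y) || (y^T != - y).
  have [/eqP sy|] := boolP (y^T == - y); last by exists 0; rewrite orbT.
  by have [x /eqP sx /eqP e] := hpsi_surj y sy; exists x; rewrite sx e.
pose psi' y := xchoose (inv y).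
have psi'P y : skewsym y -> skewsym (psi' y) /\ psi (psi' y) = y.
  move=> sy; have := xchooseP (inv y); rewrite -/(psi' y) sy eqxx orbF.
  by case/andP=> /eqP ? /eqP.
have psi_inj x y : skewsym x -> skewsym y -> psi x = psi y -> x = y.
  move=> hx hy e; apply: (skew_eq_of_det _ _ _ hchar hn_even hx hy) => w hw.
  by rewrite -(hdet w x hw hx) -(hdet w y hw hy) e.
have hpsi' y (hy : skewsym y) := (psi'P y hy).1.
have psiK' y (hy : skewsym y) := (psi'P y hy).2.
have psiK x : skewsym x -> psi' (psi x) = x.
  by move=> hx; apply: psi_inj; rewrite ?psiK' //; [apply: hpsi' |]; apply: hpsi_Q.
have tpsi := preserver_tame hphi_Q hpsi_Q hdet.
have tpsi' := preserver_inverse_tame hdet _ hpsi' psiK'.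
have psiD x y := tame_additive hchar hn_even F5 tpsi tpsi' psiK psiK' x y hpsi0.
have psiZ a x := tame_homogeneous hchar hn_even F5 tpsi tpsi' psiK psiK' a x hpsi0.
have det_psi y : skewsym y -> \det (psi y) = \det y.
  (* It is not yet known that [phi 0 = 0]. For [s != 0], scaling by [s^-1] and homogeneity of [psi]
     reduce [\det (psi y + s *: phi 0)] to [hdet] at [0] and [s^-1 *: y]. *)
  move=> hy; apply: (det_line_const _ _ (psi y) (phi 0)); first by apply: hF; lia.
  move=> s s0; apply: (mulfI (expf_neq0 n (invr_neq0 s0))).
  rewrite -!detZ scalerDr scalerA mulVf // scale1r addrC -psiZ // hdet //.
    by rewrite add0r.
  exact: skewZ.
have phi_psi x : skewsym x -> phi x = psi x.
  move=> hx; apply: (skew_eq_of_det _ _ _ hchar hn_even (hphi_Q _ hx) (hpsi_Q _ hx)).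
  (* Writing [w] as [psi (psi' w)], both determinants become [\det (psi' w + x)]: one by [hdet], the
     other by additivity and [det_psi]. *)
  move=> w hw; rewrite -(psiK' w hw) -psiD ?det_psi //; try exact: hpsi'.
    by rewrite addrC hdet 1?addrC //; apply: hpsi'.
  by apply: skewD => //; apply: hpsi'.
by split=> //; split=> //; split=> // x y; apply: psiD.
Qed.
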